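(* Let $I\subset\mathbb{R}$ be a nondegenerate interval, let $n\in\mathbb{N}$, and let $\omega:I\to\mathbb{R}^n$ be an $n$-dimensional positive Chebyshev system over $I$. Let $t\in\mathbb{R}_+^n$ and $f:I\to\mathbb{R}$. If $f$ is cyclically $(t,\omega)$-convex on $I$, then $f$ is $(r,\omega)$-convex on $I$ for all $r\in\mathbb{Q}_+^n$.
   Context: $\mathbb{N}$ is the set of positive integers; $\mathbb{R}_+$, $\mathbb{Q}_+$ are the sets of positive reals and positive rationals. $\sigma_k(I):=\{(x_1,\dots,x_k)\in I^k\mid x_1<\dots<x_k\}$. For $\omega=(\omega_1,\dots,\omega_k):I\to\mathbb{R}^k$ and $(x_1,\dots,x_k)\in\sigma_k(I)$, $\Phi_\omega(x_1,\dots,x_k):=\det\big(\omega_i(x_j)\big)_{i,j=1}^k$. $\omega$ is a $k$-dimensional positive Chebyshev system over $I$ if $\Phi_\omega>0$ on $\sigma_k(I)$. For an $n$-dimensional $\omega$ and $f:I\to\mathbb{R}$, $(\omega,f):=(\omega_1,\dots,\omega_n,f)$. For $t=(t_1,\dots,t_n)\in\mathbb{R}_+^n$, $f:I\to\mathbb{R}$ is $(t,\omega)$-convex on $I$ if $$\Phi_{(\omega,f)}\big(x,x+t_1h,x+(t_1+t_2)h,\dots,x+(t_1+\dots+t_n)h\big)\ge0$$ for all $h>0$ and $x\in I$ with $x+(t_1+\dots+t_n)h\in I$. For a permutation $\pi$ of $\{1,\dots,n\}$, $t\circ\pi:=(t_{\pi(1)},\dots,t_{\pi(n)})$. $f$ is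 cyclically $(t,\omega)$-convex on $I$ if it is $(t\circ\pi,\omega)$-convex on $I$ for all cyclic permutations $\pi$ of $\{1,\dots,n\}$, i.e., all cyclic shifts $\pi(i)\equiv i+c \pmod n$ (including the identity). *)

(* Defs.v *)
From HB Require Import structures.
From mathcomp Require Import all_boot all_order all_fingroup all_algebra.
From mathcomp Require Import boolp classical_sets reals normedtype.

Set Implicit Arguments.
Unset Strict Implicit.
Unset Printing Implicit Defensive.

Import Order.TTheory GRing.Theory Num.Theory.
Local Open Scope classical_set_scope.
Local Open Scope ring_scope.

(* Functions on an interval I are represented by total functions on R; every
   predicate below only evaluates them at points of I when I is an interval
   (given, for convexity, positive t). *)

Definition sigma (R : realType) (k : nat) (I : set R) : set ('I_k -> R) :=
  [set x | (forall i, I (x i)) /\ (forall i j : 'I_k, (i < j)%N -> x i < x j)].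

Definition Phi (R : realType) (k : nat) (w : 'I_k -> R -> R) (x : 'I_k -> R)
  : R := \det (\matrix_(i < k, j < k) w i (x j)).

Definition positive_Chebyshev (R : realType) (k : nat) (I : set R)
    (w : 'I_k -> R -> R) : Prop :=
  forall x : 'I_k -> R, sigma I x -> 0 < Phi w x.

(* (w_1, ..., w_n, f): the last index is sent to f. *)
Definition extend (R : realType) (n : nat) (w : 'I_n -> R -> R) (f : R -> R)
    : 'I_n.+1 -> R -> R :=
  fun i => if unlift ord_max i is Some j then w j else f.

(* With 0-based indices, the j-th node is x + (t_0 + ... + t_(j-1)) h. *)
Definition nodes (R : realType) (n : nat) (t : 'I_n -> R) (x h : R)
    : 'I_n.+1 -> R :=
  fun j => x + (\sum_(i < n | (i < j)%N) t i) * h.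

Definition convex_wrt (R : realType) (n : nat) (I : set R) (t : 'I_n -> R)
    (w : 'I_n -> R -> R) (f : R -> R) : Prop :=
  forall x h : R, 0 < h -> I x -> I (x + (\sum_(i < n) t i) * h) ->
    0 <= Phi (extend w f) (nodes t x h).

Definition cyclic_shift (n : nat) (p : 'S_n) : Prop :=
  exists c : nat, forall i : 'I_n, (p i = i + c %[mod n])%N.

Definition cyclically_convex_wrt (R : realType) (n : nat) (I : set R)
    (t : 'I_n -> R) (w : 'I_n -> R -> R) (f : R -> R) : Prop :=
  forall p : 'S_n, cyclic_shift p -> convex_wrt I (t \o p) w f.

(* Main.v *)
(* Extend the node sequence periodically: with T = t_1 + ... + t_n, let y_0 = x
   and let the gaps of y be e t_1, ..., e t_n, e t_1, e t_2, ...  Cyclic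
   convexity says that Phi_(w, f) >= 0 on any n + 1 consecutive terms of y.  If
   an (n + 1)-subset of the terms has a hole, fill it with a term: removing the
   first or the last of the n + 2 points gives subsets of smaller span, and
   Phi_(w, f) on the original subset is a nonnegative combination of its values
   on these two.  Hence Phi_(w, f) >= 0 on every (n + 1)-subset of the terms, in
   particular on those with indices divisible by n, whose gaps are arbitrary
   positive multiples of e T.  For r_i = k_i / q, take e = h / (q T). *)
Require Import Defs.
From mathcomp Require Import all_boot all_order all_fingroup all_algebra.
From mathcomp Require Import boolp classical_sets reals normedtype.
From mathcomp Require Import zify ring.

Set Implicit Arguments.
Unset Strict Implicit.
Unset Printing Implicit Defensive.

Import Order.TTheory GRing.Theory Num.Theory.
Local Open Scope classical_set_scope.
Local Open Scope ring_scope.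

Lemma extend_lift (R : realType) (n : nat) (w : 'I_n -> R -> R) (f : R -> R)
  (i : 'I_n) : extend w f (lift ord_max i) = w i.
Proof. by rewrite /extend liftK. Qed.

Lemma extend_max (R : realType) (n : nat) (w : 'I_n -> R -> R) (f : R -> R) :
  extend w f ord_max = f.
Proof. by rewrite /extend unlift_none. Qed.

Lemma Phi_extendE (R : realType) (n : nat) (w : 'I_n -> R -> R) (f : R -> R)
  (x : 'I_n.+1 -> R) :
  Phi (extend w f) x =
  \sum_j f (x j) * ((-1) ^+ (n + j) * Phi w (x \o lift j)).
Proof.
rewrite /Phi (expand_det_row _ ord_max); apply: eq_bigr => j _.
rewrite mxE extend_max /cofactor; congr (_ * (_ * \det _)).
by apply/matrixP => a b; rewrite !mxE extend_lift.
Qed.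

Lemma Phi_extend_id (R : realType) (n : nat) (w : 'I_n -> R -> R) (i : 'I_n)
  (x : 'I_n.+1 -> R) : Phi (extend w (w i)) x = 0.
Proof.
apply: (determinant_alternate (i1 := lift ord_max i) (i2 := ord_max)).
  by rewrite eq_sym neq_lift.
by move=> j; rewrite !mxE extend_lift extend_max.
Qed.

(** The expansion along the last row is linear in [f], and each [w i] put in place of [f] produces
    two equal rows. *)
Lemma Phi_extend_shift (R : realType) (n : nat) (w : 'I_n -> R -> R)
  (f : R -> R) (c : 'I_n -> R) (x : 'I_n.+1 -> R) :
  Phi (extend w (fun u => f u - \sum_i c i * w i u)) x = Phi (extend w f) x.
Proof.
rewrite [LHS]Phi_extendE.
under eq_bigr do rewrite mulrBl mulr_suml.
rewrite sumrB -Phi_extendE exchange_big big1 ?subr0 // => i _.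
under eq_bigr do rewrite -mulrA.
by rewrite -mulr_sumr -Phi_extendE Phi_extend_id mulr0.
Qed.

Lemma interpolation (R : realType) (n : nat) (w : 'I_n -> R -> R)
  (x : 'I_n -> R) (f : R -> R) :
  Phi w x != 0 -> exists c : 'I_n -> R,
    forall j, f (x j) - \sum_i c i * w i (x j) = 0.
Proof.
set M := \matrix_(i < n, j < n) w i (x j) => Mn0.
have Mu : M \in unitmx by rewrite unitmxE unitfE.
pose c := (\row_j f (x j)) *m invmx M.
exists (c ord0) => j; apply/eqP; rewrite subr_eq0; apply/eqP.
have /rowP/(_ j) := mulmxKV Mu (\row_j f (x j)).
by rewrite !mxE => <-; apply: eq_bigr => i _; rewrite [M i j]mxE.
Qed.

Lemma sigma_lift (R : realType) (k : nat) (I : set R) (x : 'I_k.+1 -> R)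
  (a : 'I_k.+1) : sigma I x -> sigma I (x \o lift a).
Proof.
move=> [xI xlt]; split=> [i|i j] /=; first exact: xI.
move: i j => /= i j ij.
by apply: xlt; rewrite /= /bump; lia.
Qed.

(* After subtracting from [f] the combination of the [w i] interpolating it at
   the interior points, only the two extreme values of [f] contribute. *)
Lemma Phi_extend_interior (R : realType) (I : set R) (n : nat)
  (w : 'I_n -> R -> R) (f : R -> R) (x : 'I_n.+2 -> R) (k : 'I_n.+2) :
  positive_Chebyshev I w -> sigma I x -> (0 < k < n.+1)%N ->
  0 <= Phi (extend w f) (x \o lift ord0) ->
  0 <= Phi (extend w f) (x \o lift ord_max) ->
  0 <= Phi (extend w f) (x \o lift k).
Proof.
move=> wC sx kn.
have Wgt0 a (b : 'I_n.+1) : 0 < Phi w (x \o lift a \o lift b).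
  by apply: wC; do 2!apply: sigma_lift.
(* Removing both extreme nodes leaves [n] interior ones, where the Chebyshev determinant is
   positive, so interpolation is possible. *)
have [c fc] := @interpolation _ _ w _ f (lt0r_neq0 (Wgt0 ord0 ord_max)).
rewrite -3!(Phi_extend_shift w f c).
set g := fun u : R => _.
have g0 (a : 'I_n.+2) : (0 < a < n.+1)%N -> g (x a) = 0.
  move=> an; have an' : (a.-1 < n)%N by lia.
  have [b ->] : exists b : 'I_n, a = lift ord0 (lift ord_max b); last exact: fc.
  by exists (Ordinal an'); apply/val_inj; rewrite /= /bump; lia.
rewrite !Phi_extendE.
rewrite (bigD1 ord_max) //= big1 => [|j jn]; last first.
  have := ltn_ord j; move: jn; rewrite -val_eqE /= => jn jn'.
  by rewrite g0 ?mul0r //= /bump; lia.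
rewrite addr0 -signr_odd addnn odd_double expr0 mul1r pmulr_lge0;
  last exact: Wgt0.
rewrite (bigD1 ord0) //= big1 => [|j jn]; last first.
  have := ltn_ord j; move: jn; rewrite -val_eqE /= => jn jn'.
  by rewrite g0 ?mul0r //= /bump; lia.
rewrite addr0 mulrA pmulr_lge0; last exact: Wgt0.
(* Node [k] is interior, so both extreme nodes survive, at positions 0 and [n], with exactly the
   signs found in [gmin] and [gmax]. *)
move=> gmax gmin; apply: sumr_ge0 => j _.
have [j0|j_gt0] := posnP j.
  have -> : j = ord0 by apply/val_inj.
  have <- : lift ord_max ord0 = lift k ord0 :> 'I_n.+2.
    by apply/val_inj; rewrite /= /bump; lia.
  by rewrite mulrA mulr_ge0 // ltW.
have [jn|jn] := eqVneq (val j) n.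
  have -> : j = ord_max by apply/val_inj.
  have <- : lift ord0 ord_max = lift k ord_max :> 'I_n.+2.
    by apply/val_inj; rewrite /= /bump; lia.
  by rewrite -signr_odd addnn odd_double expr0 mul1r mulr_ge0 // ltW.
have jn' := ltn_ord j; move: jn => /= jn.
by rewrite g0 ?mul0r //= /bump; lia.
Qed.

(** Induction on the span [s n - s 0]; a selection without holes is a block of consecutive terms. *)
Lemma Phi_extend_subsequence (R : realType) (I : set R) (n M : nat)
  (w : 'I_n -> R -> R) (f : R -> R) (y : nat -> R) :
  positive_Chebyshev I w ->
  (forall i, (i <= M)%N -> I (y i)) ->
  (forall i j, (i < j)%N -> y i < y j) ->
  (forall i, (i + n <= M)%N ->
    0 <= Phi (extend w f) (fun j : 'I_n.+1 => y (i + j)%N)) ->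
  forall s : nat -> nat,
  (forall i j, (i < j <= n)%N -> (s i < s j)%N) -> (s n <= M)%N ->
  0 <= Phi (extend w f) (fun j : 'I_n.+1 => y (s j)).
Proof.
move=> wC yI ylt ycons s.
have [d] := ubnP (s n - s 0)%N; elim: d => // d IH in s * => sd slt sM.
have [/forallP sS|] := boolP [forall j : 'I_n, s j.+1 == (s j).+1].
  have sE j : (j <= n)%N -> s j = (s 0 + j)%N.
    elim: j => [|j IHj] jn; first by rewrite addn0.
    by rewrite (eqP (sS (Ordinal jn))) /= IHj ?addnS // ltnW.
  have -> : (fun j : 'I_n.+1 => y (s j)) = (fun j : 'I_n.+1 => y (s 0 + j)%N).
    by apply/funext => j; rewrite sE // -ltnS.
  by apply: ycons; rewrite -sE.
rewrite negb_forall => /existsP[[j jn] /= sj].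
have sj1 := slt j j.+1.
(* The hole after [s j] is filled with [(s j).+1], which takes position [j.+1] in [s']; deleting
   that position gives back [s]. *)
pose s' i := if (i <= j)%N then s i else if i == j.+1 then (s j).+1 else s i.-1.
have s'lt a b : (a < b <= n.+1)%N -> (s' a < s' b)%N.
  move=> ab; rewrite /s'.
  have h1 := slt a b; have h2 := slt a b.-1; have h3 := slt a.-1 b.-1.
  have h4 := slt a j; have h5 := slt j.+1 b.-1.
  have h6 : a = j -> s a = s j by move=> ->.
  have h7 : b.-1 = j.+1 -> s b.-1 = s j.+1 by move=> ->.
  by do !case: ifP; lia.
have s'n : s' n.+1 = s n by rewrite /s'; do !case: ifP => //=; lia.
have s'0 : s' 0%N = s 0%N by [].
have kn : (j.+1 < n.+2)%N by lia.
have -> : (fun i : 'I_n.+1 => y (s i)) =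
    (fun i : 'I_n.+2 => y (s' i)) \o lift (Ordinal kn).
  apply/funext => i /=; congr y; rewrite /s' /bump.
  by case: (leqP j.+1 i) => ij /=; do !case: ifP => //=; lia.
apply: (Phi_extend_interior wC) => //=.
- split=> [i|a b ab].
    apply: yI; rewrite (leq_trans _ sM) // -s'n.
    have := s'lt i n.+1; have := ltn_ord i; rewrite ltnS leq_eqVlt.
    by case/orP => [/eqP -> //|] in' /(_ _)/ltnW; apply; rewrite in' /=.
  by apply: ylt; apply: s'lt; rewrite ab -ltnS /=.
(* Either deletion shortens the span: the first index rises to [s' 1], or the last one drops to
   [s' n]. *)
- have -> : (fun i : 'I_n.+2 => y (s' i)) \o lift ord0 =
      (fun i : 'I_n.+1 => y ((s' \o S) i)) by [].
  have := s'lt 0%N 1%N; have := s'lt 1%N n.+1.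
  move=> h1 h2; apply: IH => [|a b ab|] /=; rewrite ?s'n //.
    by lia.
  exact: s'lt.
- have -> : (fun i : 'I_n.+2 => y (s' i)) \o lift ord_max =
      (fun i : 'I_n.+1 => y (s' i)).
    apply/funext => i /=; congr (y (s' _)).
    by move: i => /= i; rewrite /bump leqNgt ltn_ord.
  have h1 := s'lt n n.+1; have h2 := s'lt 0%N n.
  by apply: IH => [|a b ab|]; rewrite ?s'0; [lia|apply: s'lt; lia|lia].
Qed.

(** The product of the denominators serves as [q]. Each [k i] will count the full periods between
    two consecutive selected nodes. *)
Lemma common_denominator (n : nat) (r : 'I_n -> rat) : (forall i, 0 < r i) ->
  exists (q : nat) (k : 'I_n -> nat),
    [/\ (0 < q)%N, forall i, (0 < k i)%N & forall i, r i = (k i)%:R / q%:R].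
Proof.
move=> r_gt0; pose d i := `|denq (r i)|%N.
have d_gt0 i : (0 < d i)%N by rewrite absz_gt0 denq_neq0.
pose q := (\prod_i d i)%N; pose k i := (`|numq (r i)| * (q %/ d i))%N.
have q_gt0 : (0 < q)%N by rewrite prodn_gt0.
have dq i : (d i %| q)%N by rewrite /q (bigD1 i) //= dvdn_mulr.
exists q, k; split => // i.
  rewrite muln_gt0 absz_gt0 numq_eq0 gt_eqF //= divn_gt0 //.
  exact: dvdn_leq.
rewrite -{1}[r i]divq_num_den.
have -> : numq (r i) = `|numq (r i)|%N by rewrite gez0_abs // numq_ge0 ltW.
have -> : denq (r i) = d i by rewrite /d gez0_abs // denq_ge0.
have -> : q%:R = (q %/ d i)%:R * (d i)%:R :> rat by rewrite -natrM divnK.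
rewrite /k natrM.
have : (d i)%:R != 0 :> rat by rewrite pnatr_eq0 -lt0n.
have : (q %/ d i)%:R != 0 :> rat.
  by rewrite pnatr_eq0 -lt0n divn_gt0 // dvdn_leq.
move=> h1 h2; rewrite -!pmulrn; field.
by rewrite h1 h2.
Qed.

(** Composing [t] with this map extends it periodically to all natural indices. *)
Definition cyclic_index (n : nat) (n_gt0 : (0 < n)%N) (m : nat) : 'I_n :=
  Ordinal (ltn_pmod m n_gt0).

Lemma cyclic_index_shift_inj (n : nat) (n_gt0 : (0 < n)%N) (c : nat) :
  injective (fun i : 'I_n => cyclic_index n_gt0 (i + c)).
Proof.
move=> i j /(congr1 val) /= /eqP; rewrite eqn_modDr !modn_small // => /eqP.
exact: val_inj.
Qed.

Lemma cyclic_shift_perm (n : nat) (n_gt0 : (0 < n)%N) (c : nat) :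
  cyclic_shift (perm (cyclic_index_shift_inj (n_gt0 := n_gt0) (c := c))).
Proof. by exists c => i; rewrite permE /= modn_mod. Qed.

Lemma sum_ord_lt (R : realType) (n : nat) (F : nat -> R) (j : nat) :
  (j <= n)%N -> \sum_(i < n | (i < j)%N) F i = \sum_(0 <= i < j) F i.
Proof. by move=> jn; rewrite big_mkord (big_ord_widen n). Qed.

(** Over whole periods only the total of [t] matters, which is why the individual [t i] disappear
    from the conclusion. *)
Lemma sum_cyclic_index (R : realType) (n : nat) (n_gt0 : (0 < n)%N)
  (t : 'I_n -> R) (K : nat) :
  \sum_(0 <= m < n * K) t (cyclic_index n_gt0 m) = (\sum_i t i) *+ K.
Proof.
elim: K => [|K IHK]; first by rewrite muln0 big_geq.
rewrite mulnS addnC (big_cat_nat (n := (n * K)%N)) ?leq_addr //= IHK mulrSr.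
congr (_ + _); rewrite -{1}[(n * K)%N]add0n big_addn addKn big_mkord.
apply: eq_bigr => i _; congr t; apply/val_inj.
by rewrite /= addnC mulnC modnMDl modn_small.
Qed.

Theorem theorem5 (R : realType) (I : set R)
  (I_interval : is_interval I)
  (I_nondegenerate : exists a b : R, [/\ I a, I b & a < b])
  (n : nat) (n_gt0 : (0 < n)%N)
  (w : 'I_n -> R -> R) (w_Chebyshev : positive_Chebyshev I w)
  (t : 'I_n -> R) (t_gt0 : forall i, 0 < t i) (f : R -> R) :
  cyclically_convex_wrt I t w f ->
  forall r : 'I_n -> rat, (forall i, 0 < r i) ->
    convex_wrt I (fun i => ratr (r i)) w f.
Proof.
move=> fC r /common_denominator[q [k [q_gt0 k_gt0 rE]]] x h h_gt0 Ix Ixh.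
pose T := \sum_i t i.
have T_gt0 : 0 < T.
  rewrite /T (bigD1 (Ordinal n_gt0)) //= ltr_pwDl ?sumr_ge0 // => i _.
  exact: ltW.
pose e := h / (q%:R * T).
have qR_gt0 : 0 < q%:R :> R by rewrite ltr0n.
have e_gt0 : 0 < e by rewrite divr_gt0 // mulr_gt0.
pose y m := x + (\sum_(0 <= i < m) t (cyclic_index n_gt0 i)) * e.
have yD m l : y (m + l)%N =
    y m + (\sum_(0 <= i < l) t (cyclic_index n_gt0 (i + m))) * e.
  rewrite /y (big_cat_nat (n := m)) ?leq_addr //= mulrDl addrA.
  congr (_ + _ * _).
  by rewrite -{1}[m]add0n big_addn addKn.
have ylt i j : (i < j)%N -> y i < y j.
  move=> ij; rewrite -(subnKC ij) addSnnS yD ltrDl mulr_gt0 //.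
  rewrite big_nat_recl //= ltr_pwDl ?sumr_ge0 // => l _; exact: ltW.
(* The choice of [e] gives each period the length [e * T = h / q]. *)
have ymul K : y (n * K)%N = x + K%:R / q%:R * h.
  rewrite /y sum_cyclic_index -/T -mulr_natl /e; congr (_ + _).
  by field; rewrite !gt_eqF.
(* Node [j] of [r] lies [k 0 + ... + k (j - 1)] periods after [x]. The sum is constant from [j = n]
   on, so [s] increases strictly only up to [n]. *)
pose s j := (n * \sum_(i < n | (i < j)%N) k i)%N.
have ys j : y (s j) = x + (\sum_(i < n | (i < j)%N) ratr (r i)) * h.
  rewrite ymul natr_sum mulr_suml; congr (_ + _ * _); apply: eq_bigr => i _.
  by rewrite rE fmorph_div /= !ratr_nat.
have slt i j : (i < j <= n)%N -> (s i < s j)%N.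
  move=> /andP[ij jn]; rewrite ltn_pmul2l //.
  have i_n := leq_trans ij jn.
  have -> : (\sum_(l < n | (l < j)%N) k l =
      \sum_(l < n | (l < i)%N) k l + \sum_(l < n | (i <= l < j)%N) k l)%N.
    rewrite (bigID (fun l : 'I_n => (l < i)%N)) /=.
    by congr (_ + _)%N; apply: eq_bigl => l; lia.
  rewrite -addn1 leq_add2l (bigD1 (Ordinal i_n)) /= ?leqnn ?ij //.
  by rewrite ltn_addr.
(* These terms lie between [y 0 = x] and the last node [y (s n)], both in [I]. *)
have yI i : (i <= s n)%N -> I (y i).
  move=> isn; apply: (I_interval _ _ Ix Ixh).
  have -> : x = y 0%N by rewrite /y big_geq // mul0r addr0.
  have <- : y (s n) = y 0%N + (\sum_i ratr (r i)) * h.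
    rewrite ys /y big_geq // mul0r addr0; congr (_ + _ * _).
    by apply: eq_bigl => i0; rewrite ltn_ord.
  apply/andP; split.
    by case: i {isn} => // i; exact/ltW/ylt.
  by move: isn; rewrite leq_eqVlt => /orP[/eqP -> //|/ylt/ltW].
have -> : nodes (fun i => ratr (r i)) x h = (fun j : 'I_n.+1 => y (s j)).
  by apply/funext => j; rewrite ys.
apply: (Phi_extend_subsequence w_Chebyshev yI ylt _ slt) => // i isn.
(* The [n] gaps following [y i] are [e] times [t] shifted cyclically by [i], so cyclic convexity
   applies with base point [y i] and step [e]. *)
pose p := perm (cyclic_index_shift_inj (n_gt0 := n_gt0) (c := i)).
have tp : \sum_(l < n) (t \o p) l =
    \sum_(0 <= l < n) t (cyclic_index n_gt0 (l + i)).
  by rewrite big_mkord; apply: eq_bigr => l _; rewrite /= permE.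
have -> : (fun j : 'I_n.+1 => y (i + j)%N) = nodes (t \o p) (y i) e.
  apply/funext => j; rewrite yD /nodes; congr (_ + _ * _).
  rewrite -(sum_ord_lt (fun l => t (cyclic_index n_gt0 (l + i))) (leq_ord j)).
  by apply: eq_bigr => l _; rewrite /= permE.
apply: (fC p (cyclic_shift_perm n_gt0 i)) => //.
  by apply: yI; apply: leq_trans isn; exact: leq_addr.
by rewrite tp -yD; exact: yI.
Qed.
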